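(* Let $\mathcal{H}$ be a complex Hilbert space and let $A,B\in\mathcal{B}(\mathcal{H})$ be nonzero. Put $$S=\frac{\|B\|}{\|A\|}|A|^2+\frac{\|A\|}{\|B\|}|B^*|^2 .$$ Then $$\omega(AB)\le\frac12\sqrt{\frac14\|S\|^2+\omega(BA)^2+\frac12\,\omega\big(S\,BA+BA\,S\big)}.$$
   Context: $\mathcal{B}(\mathcal{H})$ is the $C^*$-algebra of all bounded linear operators on $\mathcal{H}$. For $X\in\mathcal{B}(\mathcal{H})$, $\|X\|$ is the operator norm, $\omega(X)=\sup_{\|x\|=1}|\langle Xx,x\rangle|$ is the numerical radius, and $|X|=(X^*X)^{1/2}$, so that $|X|^2=X^*X$ and $|X^*|^2=XX^*$. *)

(* Defs.v *)
From HB Require Import structures.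
From mathcomp Require Import all_boot all_order all_algebra.
From mathcomp Require Import sesquilinear complex.
From mathcomp Require Import all_classical all_reals all_analysis.

Set Implicit Arguments.
Unset Strict Implicit.
Unset Printing Implicit Defensive.

Import Order.TTheory GRing.Theory Num.Theory.

Local Open Scope classical_set_scope.
Local Open Scope ring_scope.
Local Open Scope complex_scope.

(* [inner] is linear in its first argument and conjugate-linear in its second
   one. As for any normed module over [R[i]], norms are [R[i]]-valued. *)
HB.mixin Record CompleteNormedModule_isHilbert (R : realType) H
    & CompleteNormedModule R[i] H := {
  inner : {dot H for Num.conj} ;
  sqr_norm_inner : forall x : H, `|x| ^+ 2 = inner x x
}.

#[short(type="hilbertType")]
HB.structure Definition Hilbert (R : realType) :=
  {H of CompleteNormedModule R[i] H & CompleteNormedModule_isHilbert R H}.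

Section operators.
Variables (R : realType) (H : hilbertType R).
Implicit Types X : H -> H.

Definition bounded_operator X : Prop :=
  linear X /\ exists M : R, forall x, `|X x| <= M%:C * `|x|.

Definition opnorm X : R :=
  sup [set complex.Re `|X x| | x in [set x : H | `|x| <= 1]].

Definition numerical_radius X : R :=
  sup [set complex.Re `|inner (X x) x| | x in [set x : H | `|x| = 1]].

(* For a bounded [X] the adjoint exists by the Riesz representation theorem
   (this uses completeness), and it is unique. *)
Definition adjoint X : H -> H :=
  get [set Y : H -> H | bounded_operator Y /\
                        forall x y, inner (X x) y = inner x (Y y)].

(* In [R[i]], [0 <= z] means that [z] is real and nonnegative. *)
Definition positive_operator X : Prop :=
  bounded_operator X /\ forall x, 0 <= inner (X x) x.

(* A positive operator has exactly one positive square root. *)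
Definition sqrt_operator X : H -> H :=
  get [set P : H -> H | positive_operator P /\ P \o P = X].

Definition abs_operator X : H -> H := sqrt_operator (adjoint X \o X).

End operators.

(* Main.v *)
Require Import Defs.
From HB Require Import structures.
From mathcomp Require Import all_boot all_order all_algebra.
From mathcomp Require Import sesquilinear complex.
From mathcomp Require Import all_classical all_reals all_analysis.
From mathcomp Require Import ring lra.

Set Implicit Arguments.
Unset Strict Implicit.
Unset Printing Implicit Defensive.

Import Order.TTheory GRing.Theory Num.Theory.

Local Open Scope classical_set_scope.
Local Open Scope ring_scope.
Local Open Scope complex_scope.

(** Let [c] be a complex number of modulus one and [s > 0] with
    [s^2 = |B| / |A|], and put [T = s^-1 c B + s A^*].  Two computations with
    [T] explain the inequality.

    - Polarization.  [Re <c A B x, x> = Re <s^-1 c B x, s A^* x>] is at most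
      [|T x|^2 / 4]; choosing the phase [c] according to [x], the left-hand
      side is [|<A B x, x>|].
    - The other product.  [T T^* = S + (c B A + conj c (B A)^* )], in which
      [B A] has replaced [A B].

    As [|T|^2 = |T T^*|] ([sqr_norm_le_comp_adjoint]), it remains to bound
    [T T^*] ([norm_add_real_part]).  With [N = c B A + conj c (B A)^*],
    [|S y + N y|^2 = |S y|^2 + 2 Re <S y, N y> + |N y|^2].  Here [N] is
    symmetric, so its norm is that of its quadratic form, at most
    [2 w(B A)] ([symmetric_bound]); and [Re <S y, N y>] is the real part of
    [c <(S B A + B A S) y, y>].  So [|T T^*|^2] is at most four times the
    quantity under the square root of the theorem, and taking roots concludes
    ([abs_inner_comp_le]).

    The adjoint and the absolute value are defined by a choice, so that these
    computations rest on two existence theorems: the Riesz representation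
    theorem, by minimization of a quadratic functional ([riesz_real]), and the
    existence of the square root of a positive operator, by an iteration that
    is dominated by a scalar one ([sqrt_exists]). *)

(** * The underlying real inner product space *)

Section real_inner_product.
Variables (R : realType) (H : hilbertType R).
Implicit Types (x y z : H) (a : R) (c : R[i]).

(** The norm of [H] and the modulus on [R[i]] take complex values, whereas
    every estimate below is between real numbers: [rip] and [nrm] are the real
    inner product and the real norm that carry them. *)
Definition rip x y : R := complex.Re (inner x y).
Definition nrm x : R := complex.Re `|x|.

Lemma normE x : `|x| = (nrm x)%:C.
Proof.
by rewrite /nrm; have /ger0_Im := normr_ge0 x; case: `|x| => ? ? /= ->.
Qed.

Lemma nrm_ge0 x : 0 <= nrm x.
Proof. by rewrite -ler0c -normE. Qed.

Lemma nrm_eq0 x : (nrm x == 0) = (x == 0).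
Proof. by rewrite -(inj_eq (@complexI R)) -normE normr_eq0. Qed.

Lemma nrm0 : nrm (0 : H) = 0.
Proof. by apply/eqP; rewrite nrm_eq0. Qed.

Lemma nrmD x y : nrm (x + y) <= nrm x + nrm y.
Proof. by rewrite -lecR rmorphD /= -!normE ler_normD. Qed.

Lemma nrmZ c x : nrm (c *: x) = complex.Re `|c| * nrm x.
Proof.
apply: (@complexI R).
by rewrite -normE normrZ normE rmorphM /= RRe_real ?normr_real.
Qed.

Lemma nrmZr a x : nrm (a%:C *: x) = `|a| * nrm x.
Proof. by rewrite nrmZ normc_def /= expr0n addr0 sqrtr_sqr. Qed.

Lemma nrmN x : nrm (- x) = nrm x.
Proof. by rewrite /nrm normrN. Qed.

Lemma ripC x y : rip x y = rip y x.
Proof.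
rewrite /rip hermC /= expr0 mul1r.
by case: (inner y x).
Qed.

Lemma ripDl x y z : rip (x + y) z = rip x z + rip y z.
Proof. by rewrite /rip linearDl raddfD. Qed.
Lemma ripDr x y z : rip x (y + z) = rip x y + rip x z.
Proof. by rewrite /rip linearDr raddfD. Qed.
Lemma ripNl x y : rip (- x) y = - rip x y.
Proof. by rewrite /rip linearNl raddfN. Qed.
Lemma ripNr x y : rip x (- y) = - rip x y.
Proof. by rewrite /rip linearNr raddfN. Qed.
Lemma ripZl a x y : rip (a%:C *: x) y = a * rip x y.
Proof.
rewrite /rip linearZl_LR /=; case: (inner x y) => u v /=.
by rewrite mul0r subr0.
Qed.
Lemma ripZr a x y : rip x (a%:C *: y) = a * rip x y.
Proof. by rewrite ripC ripZl ripC. Qed.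

Lemma innerZl c x y : inner (c *: x) y = c * inner x y.
Proof. by rewrite linearZl_LR. Qed.
Lemma innerZr c x y : inner x (c *: y) = conjc c * inner x y.
Proof. by rewrite linearZr_LR. Qed.

Lemma rip_sqr x : rip x x = nrm x ^+ 2.
Proof. by rewrite /rip -sqr_norm_inner normE -rmorphXn. Qed.

Lemma nrm_sqrD x y : nrm (x + y) ^+ 2 = nrm x ^+ 2 + nrm y ^+ 2 + 2 * rip x y.
Proof. by rewrite -!rip_sqr ripDl !ripDr (ripC y x); ring. Qed.

Lemma ripi x y : rip x ('i *: y) = - rip ('i *: x) y.
Proof. by rewrite /rip innerZl innerZr; case: (inner x y) => a b /=; ring. Qed.

(** The real part determines the whole sesquilinear form, so an identity
    between inner products only has to be checked on [rip]. *)
Lemma innerE x y : inner x y = rip x y +i* rip x ('i *: y).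
Proof.
rewrite /rip innerZr; case: (inner x y) => a b /=.
by rewrite mul0r mulN1r opprK add0r.
Qed.

(** Cauchy-Schwarz comes for free from the triangle inequality, which the
    normed module structure already provides: square it and cancel. *)
Lemma rip_le x y : rip x y <= nrm x * nrm y.
Proof.
have : nrm (x + y) ^+ 2 <= (nrm x + nrm y) ^+ 2.
  by rewrite ler_sqr ?nrmD ?nnegrE ?addr_ge0 ?nrm_ge0.
rewrite nrm_sqrD; set u := nrm x; set v := nrm y; set w := rip x y; lra.
Qed.

End real_inner_product.

(** * Bounded operators *)

Section bounded.
Variables (R : realType) (H : hilbertType R).
Implicit Types (X : H -> H).

Lemma bopD X : bounded_operator X -> forall x y, X (x + y) = X x + X y.
Proof. by case=> lX _ x y; have := lX 1 x y; rewrite !scale1r. Qed.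
Lemma bop0 X : bounded_operator X -> X 0 = 0.
Proof.
by move=> /bopD/(_ 0 0)/eqP; rewrite addr0 addrC -subr_eq subrr => /eqP.
Qed.
Lemma bopZ X : bounded_operator X -> forall c x, X (c *: x) = c *: X x.
Proof.
move=> bX c x; case: (bX) => lX _; have := lX c x 0.
by rewrite !addr0 (bop0 bX) addr0.
Qed.
Lemma bopN X : bounded_operator X -> forall x, X (- x) = - X x.
Proof. by move=> bX x; rewrite -scaleN1r bopZ // scaleN1r. Qed.

Lemma bop_bound X : bounded_operator X ->
  exists2 M : R, 0 <= M & forall x, nrm (X x) <= M * nrm x.
Proof.
case=> _ [M hM]; exists `|M| => // x.
have := hM x; rewrite !normE -rmorphM /= lecR => /le_trans; apply.
by rewrite ler_wpM2r ?nrm_ge0 // ler_norm.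
Qed.

Lemma bopI X (M : R) : (forall x y, X (x + y) = X x + X y) ->
  (forall c x, X (c *: x) = c *: X x) ->
  (forall x, nrm (X x) <= M * nrm x) -> bounded_operator X.
Proof.
move=> XD XZ XM; split; first by move=> a u v /=; rewrite XD XZ.
by exists M => x; rewrite !normE -rmorphM lecR.
Qed.

Lemma add_opE X Y x : (X + Y) x = X x + Y x.
Proof. by []. Qed.
Lemma scale_opE (c : R[i]) X x : (c *: X) x = c *: X x.
Proof. by []. Qed.

Lemma bop_comp X Y : bounded_operator X -> bounded_operator Y ->
  bounded_operator (X \o Y).
Proof.
move=> bX bY; have [M M0 hM] := bop_bound bX; have [N N0 hN] := bop_bound bY.
apply: (@bopI _ (M * N)) => [x y|c x|x] /=.
- by rewrite (bopD bY) (bopD bX).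
- by rewrite (bopZ bY) (bopZ bX).
- by apply: (le_trans (hM _)); rewrite -mulrA ler_wpM2l.
Qed.

Lemma bop_add X Y : bounded_operator X -> bounded_operator Y ->
  bounded_operator (X + Y).
Proof.
move=> bX bY; have [M M0 hM] := bop_bound bX; have [N N0 hN] := bop_bound bY.
apply: (@bopI _ (M + N)) => [x y|c x|x].
- by rewrite !add_opE (bopD bX) (bopD bY) addrACA.
- by rewrite !add_opE (bopZ bX) (bopZ bY) scalerDr.
- by rewrite add_opE; apply: (le_trans (nrmD _ _)); rewrite mulrDl lerD.
Qed.

Lemma bop_scale (c : R[i]) X : bounded_operator X -> bounded_operator (c *: X).
Proof.
move=> bX; have [M M0 hM] := bop_bound bX.
apply: (@bopI _ (complex.Re `|c| * M)) => [x y|d x|x].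
- by rewrite !scale_opE (bopD bX) scalerDr.
- by rewrite !scale_opE (bopZ bX) !scalerA mulrC.
- by rewrite scale_opE nrmZ -mulrA ler_wpM2l // -ler0c RRe_real ?normr_real.
Qed.

End bounded.

(** * Completeness, the Riesz representation theorem and adjoints *)

Section completeness.
Variables (R : realType) (H : hilbertType R).
Implicit Types (x y : H).

(** Both limits taken in this development (the minimizing sequence for the
    Riesz theorem and the iteration for the square root) converge at the speed
    [2 / (n + 1)].  With an explicit speed, identities pass to the limit by
    norm estimates and [le0_rate] alone. *)
Definition rate (n : nat) : R := 2 / n.+1%:R.

Lemma rate_ge0 n : 0 <= rate n.
Proof. by rewrite divr_ge0. Qed.

Lemma rate_small (d : R) : 0 < d -> exists n : nat, rate n <= d.
Proof.
move=> d0; have [k] : exists k : nat, 0 + k.+1%:R^-1 < d / 2.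
  by apply: ltr_add_invr; rewrite divr_gt0.
by rewrite add0r ltr_pdivlMr // mulrC => /ltW ?; exists k.
Qed.

Lemma le0_rate (z K : R) : (forall n : nat, z <= K * rate n) -> z <= 0.
Proof.
move=> zK; rewrite leNgt; apply/negP => z0.
have [n] : exists n : nat, rate n <= z / (`|K| + 1) / 2.
  by apply: rate_small; rewrite !divr_gt0 // ltr_wpDl.
have K1 : 0 < `|K| + 1 by rewrite ltr_wpDl.
have := zK n; set t := rate _ => zt.
rewrite ler_pdivlMr // ler_pdivlMr // => tz.
have t0 : 0 <= t by exact: rate_ge0.
have : K * t <= `|K| * t by rewrite ler_wpM2r // ler_norm.
nra.
Qed.

Lemma rate_nonincreasing n m : (n <= m)%N -> rate m <= rate n.
Proof. by move=> nm; rewrite ler_wpM2l // lef_pV2 ?posrE // ler_nat. Qed.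

Lemma cauchy_rate_cvg (u : nat -> H) :
  (forall n m : nat, (n <= m)%N -> nrm (u m - u n) <= rate n) ->
  exists l, forall n, nrm (l - u n) <= rate n.
Proof.
move=> hu.
have /cauchy_cvg cu : cauchy (u @ \oo).
  apply: cauchy_exP => e e0.
  have e0' : 0 < complex.Re e by move: e0; rewrite ltcE => /andP[].
  have [n hn] : exists n : nat, rate n <= complex.Re e / 2.
    by apply: rate_small; rewrite divr_gt0.
  exists (u n); exists n => // m /= nm; rewrite -ball_normE /= distrC normE.
  rewrite ltcE; move: e0; rewrite ltcE /= => /andP[-> _] /=.
  apply: (le_lt_trans (hu _ _ nm)); apply: (le_lt_trans hn); lra.
exists (lim (u @ \oo)) => n; apply/ler_addgt0Pr => d d0.
have /cvgrPdist_lt/(_ d%:C) := cu; rewrite ltcR => /(_ d0)[N _]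
  /(_ (maxn n N) (leq_maxr _ _)) /=; rewrite normE ltcR => /ltW h.
rewrite -(subrK (u (maxn n N)) (lim _)) -addrA.
by apply: (le_trans (nrmD _ _)); rewrite [leRHS]addrC lerD // hu // leq_maxl.
Qed.

Lemma rip_inj (u v : H) : (forall x, rip x u = rip x v) -> u = v.
Proof.
move=> h; apply/eqP; rewrite -subr_eq0 -nrm_eq0 -sqrf_eq0 -rip_sqr.
by rewrite ripDr ripNr h subrr.
Qed.

Lemma parallelogram x y :
  nrm (x - y) ^+ 2 = 2 * nrm x ^+ 2 + 2 * nrm y ^+ 2 - nrm (x + y) ^+ 2.
Proof. by rewrite -!rip_sqr !(ripDl, ripDr, ripNl, ripNr) (ripC y x); ring. Qed.

(** The representing vector is the minimizer of
    [phi x = |x|^2 - 2 g x].  By the parallelogram law a minimizing sequence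
    is Cauchy; comparing [phi] at [u n] and at [u n + d x] for the small step
    [d = 1 / (n + 1)] shows that [g x - rip x (u n)] is of order [d], so that
    the limit of [u] represents [g]. *)
Lemma riesz_real (g : H -> R) (M : R) : (forall x y, g (x + y) = g x + g y) ->
  (forall (a : R) x, g (a%:C *: x) = a * g x) -> (forall x, g x <= M * nrm x) ->
  exists l, forall x, g x = rip x l.
Proof.
move=> gD gZ gM; pose phi x := nrm x ^+ 2 - 2 * g x.
pose m := inf (range phi).
have lbphi : has_lbound (range phi).
  exists (- M ^+ 2) => _ [x _ <-]; rewrite /phi.
  have := gM x; have := sqr_ge0 (nrm x - M); nra.
have m_le x : m <= phi x by apply: ge_inf => //; exists x.
(* The excess is the square of 1 / (n + 1) because the parallelogram law
   controls the square of the distance. *)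
have /choice[u hu] : forall n : nat, exists x, phi x < m + (n.+1%:R^-1) ^+ 2.
  have hi : has_inf (range phi) by split=> //; exists (phi 0); exists 0.
  move=> n; have e0 : (0 : R) < n.+1%:R^-1 ^+ 2 by rewrite exprn_gt0.
  by have [_ [x _ <-] hx] := inf_adherent e0 hi; exists x.
have gN x : g (- x) = - g x.
  by rewrite -scaleN1r -[-1](rmorphN1 (real_complex R)) gZ mulN1r.
have mid x y : nrm (x - y) ^+ 2 =
    2 * phi x + 2 * phi y - 4 * phi ((1/2)%:C *: (x + y)).
  rewrite parallelogram /phi nrmZr gZ gD exprMn real_normK ?num_real //.
  by field.
have [l hl] : exists l, forall n, nrm (l - u n) <= rate n.
  apply: cauchy_rate_cvg => n k nk.
  have nk' : (k.+1%:R^-1 : R) <= n.+1%:R^-1.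
    by rewrite lef_pV2 ?posrE // ler_nat.
  have k0 : (0 : R) <= k.+1%:R^-1 by [].
  rewrite -(@ler_sqr R) ?nnegrE ?nrm_ge0 ?rate_ge0 // mid.
  have := hu n; have := hu k; have := m_le ((1/2)%:C *: (u k + u n)).
  have : k.+1%:R^-1 ^+ 2 <= n.+1%:R^-1 ^+ 2 :> R.
    by rewrite ler_sqr ?nnegrE ?invr_ge0.
  rewrite exprMn; move: (n.+1%:R^-1 ^+ 2) (k.+1%:R^-1 ^+ 2).
  by move: (phi (u k)) (phi (u n)) (phi _); clear => *; lra.
suff le_g x : g x <= rip x l.
  exists l => x; apply/eqP; rewrite eq_le le_g /=.
  by have := le_g (- x); rewrite gN ripNl lerN2.
rewrite -subr_le0; apply: (@le0_rate _ ((1 + nrm x ^+ 2) / 4 + nrm x)) => n.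
pose d : R := n.+1%:R^-1; have d0 : 0 < d by rewrite invr_gt0.
have := m_le (u n + d%:C *: x); have := hu n.
rewrite /phi -!rip_sqr gD gZ !(ripDl, ripDr, ripZl, ripZr) (ripC (u n) x) -/d.
move=> h1 h2.
have h3 : 2 * d * (g x - rip x (u n)) <= d * (d * (1 + rip x x)) by nra.
have h4 : 2 * (g x - rip x (u n)) <= d * (1 + rip x x).
  by move: h3; rewrite mulrAC [_ * d]mulrC ler_pM2l // mulrC.
have := rip_le x (u n - l); rewrite ripDr ripNr -(opprB l) nrmN => h5.
have := ler_wpM2l (nrm_ge0 x) (hl n); rewrite /rate -/d => h6.
move: h4 h5 h6; rewrite rip_sqr; move: (nrm x * nrm _) => w; nra.
Qed.

Lemma inner_eq_of_rip (X : H -> H) (y l : H) : bounded_operator X ->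
  (forall x, rip (X x) y = rip x l) -> forall x, inner (X x) y = inner x l.
Proof.
move=> bX h x.
by rewrite !innerE !ripi -(bopZ bX) !h.
Qed.

(** Apply Riesz to [x |-> rip (X x) y] for each [y].  Uniqueness of the
    representing vector makes the adjoint linear, and
    [|Y u|^2 = rip (X (Y u)) u] bounds it by the bound of [X]. *)
Lemma adjoint_exists (X : H -> H) : bounded_operator X ->
  exists Y : H -> H,
    bounded_operator Y /\ forall x y, inner (X x) y = inner x (Y y).
Proof.
move=> bX; have [M M0 hM] := bop_bound bX.
have /choice[Y hY] : forall y, exists l, forall x, rip (X x) y = rip x l.
  move=> y; apply: (@riesz_real _ (M * nrm y)) => [u v|a u|u].
  - by rewrite (bopD bX) ripDl.
  - by rewrite (bopZ bX) ripZl.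
  - by apply: (le_trans (rip_le _ _)); rewrite mulrAC ler_wpM2r ?nrm_ge0.
have hiY x y : inner (X x) y = inner x (Y y) by apply: inner_eq_of_rip.
exists Y; split=> //; apply: (@bopI _ _ _ M) => [u v|c u|u].
- by apply: rip_inj => x; rewrite ripDr -!hY ripDr.
- by apply: rip_inj => x; rewrite /rip innerZr -!hiY innerZr.
- have h : nrm (Y u) ^+ 2 <= M * nrm (Y u) * nrm u.
    rewrite -rip_sqr -hY; apply: (le_trans (rip_le _ _)).
    by rewrite ler_wpM2r ?nrm_ge0.
  have := nrm_ge0 (Y u); rewrite le_eqVlt => /predU1P[<-|Y0].
    by rewrite mulr_ge0 ?nrm_ge0.
  by rewrite -(ler_pM2l Y0) -expr2 mulrCA mulrA.
Qed.

Lemma adjointP (X : H -> H) : bounded_operator X ->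
  bounded_operator (adjoint X) /\
  forall x y, inner (X x) y = inner x (adjoint X y).
Proof.
move=> /adjoint_exists[Y hY].
by have := @getPex _ [set Y : H -> H | _ ] (ex_intro _ Y hY).
Qed.

Lemma bop_adjoint (X : H -> H) :
  bounded_operator X -> bounded_operator (adjoint X).
Proof. by move=> /adjointP[]. Qed.

Lemma rip_adjoint (X : H -> H) : bounded_operator X ->
  forall x y, rip (X x) y = rip x (adjoint X y).
Proof. by move=> /adjointP[_ h] x y; rewrite /rip h. Qed.

End completeness.
Arguments rate {R}.

(** * Symmetric operators and the square root of a positive operator *)

Section symmetric_operators.
Variables (R : realType) (H : hilbertType R).
Implicit Types (N X Y P Q : H -> H).

Definition symmetric_operator N := forall x y, rip (N x) y = rip x (N y).

(** The norm of a symmetric operator is controlled by its quadratic form: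
    polarize [rip (N x) y], then take for [y] the multiple of [N x] that has
    the norm of [x]. *)
Lemma symmetric_bound N (w : R) : bounded_operator N -> symmetric_operator N ->
  (forall x, `|rip (N x) x| <= w * nrm x ^+ 2) ->
  forall x, nrm (N x) <= w * nrm x.
Proof.
move=> bN sN hN x.
have pol y : 2 * rip (N x) y <= w * (nrm x ^+ 2 + nrm y ^+ 2).
  have := hN (x + y); have := hN (x - y).
  rewrite !ler_norml => /andP[h1 _] /andP[_ h2].
  move: h1 h2; rewrite parallelogram.
  rewrite !(bopD bN, bopN bN, ripDl, ripDr, ripNl, ripNr).
  rewrite [rip (N y) x]sN [rip y _]ripC.
  move: (rip (N x) x) (rip (N x) y) (rip (N y) y) (nrm (x + y)) (nrm x) (nrm y).
  move=> a b c d e f; lra.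
have := nrm_ge0 x; rewrite le_eqVlt => /predU1P[x0|x0].
  have /eqP := esym x0; rewrite nrm_eq0 => /eqP->.
  by rewrite (bop0 bN) !nrm0 mulr0.
have w0 : 0 <= w.
  by rewrite -(pmulr_lge0 _ (exprn_gt0 2 x0)) (le_trans _ (hN x)).
have := nrm_ge0 (N x); rewrite le_eqVlt => /predU1P[<-|n0].
  by rewrite mulr_ge0 // ltW.
have := pol ((nrm x / nrm (N x))%:C *: N x).
rewrite nrmZr ripZr rip_sqr ger0_norm ?divr_ge0 ?nrm_ge0 // divfK ?gt_eqF //.
have -> : nrm x / nrm (N x) * nrm (N x) ^+ 2 = nrm x * nrm (N x).
  by rewrite expr2 mulrA divfK ?gt_eqF.
move: x0 n0; move: (nrm x) (nrm (N x)) => a b a0 b0 h.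
rewrite -(ler_pM2l a0); nra.
Qed.

(** The point is that the quadratic form of a symmetric operator is real:
    moving ['i] across [Q] shows that its imaginary part is its own
    opposite. *)
Lemma symmetric_positive Q : bounded_operator Q -> symmetric_operator Q ->
  (forall x, 0 <= rip (Q x) x) -> positive_operator Q.
Proof.
move=> bQ sQ Q0; split=> // x.
have i0 : rip (Q x) ('i *: x) = 0.
  have sym_i : rip (Q ('i *: x)) x = rip (Q x) ('i *: x) by rewrite sQ ripC.
  have := ripi (Q x) x; rewrite -(bopZ bQ) sym_i; lra.
by rewrite innerE i0 -[_ +i* 0]/((rip (Q x) x)%:C) ler0c.
Qed.

(** If [Y] is a fixed point of [Y = (Q + Y^2) / 2] then
    [(1 - Y)^2 = 1 - Q], so this iteration produces square roots. *)
Fixpoint sqrt_iter Q (n : nat) : H -> H :=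
  if n is n'.+1 then (2^-1)%:C *: (Q + (sqrt_iter Q n' \o sqrt_iter Q n'))
  else 0.

(** The same iteration for the scalar [Q = 1]; it increases to [1]. *)
Fixpoint sqrt_majorant (n : nat) : R :=
  if n is n'.+1 then (1 + sqrt_majorant n' ^+ 2) / 2 else 0.

Lemma sqrt_majorant_ge0 n : 0 <= sqrt_majorant n.
Proof. by case: n => //= n; rewrite divr_ge0 // addr_ge0 // sqr_ge0. Qed.

(** The gap [d n = 1 - y n] obeys [d (n + 1) = d n - (d n)^2 / 2], and
    [2 / (n + 1)] is a supersolution of this recursion. *)
Lemma sqrt_majorant_bounds n : 1 - rate n <= sqrt_majorant n <= 1.
Proof.
elim: n => [|n /andP[IH1 IH2]] /=.
  by rewrite /rate divr1; apply/andP; split; lra.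
have y0 := sqrt_majorant_ge0 n; move: (sqrt_majorant n) IH1 IH2 y0 => y.
rewrite /rate => h1 h2 h0; apply/andP; split; last by nra.
have n1 : (0 : R) < n.+1%:R by [].
have n2 : (0 : R) < n.+2%:R by [].
have : n.+2%:R = n.+1%:R + 1 :> R by rewrite -natr1.
move: (n.+1%:R : R) (n.+2%:R : R) n1 n2 h1 => a b a0 b0 h1 ba.
have {}h1 : (1 - y) * a <= 2 by rewrite -ler_pdivlMr //; lra.
have -> : 1 - 2 / b = (b - 2) / b by rewrite mulrBl divff ?gt_eqF.
rewrite ler_pdivrMr // ba; nra.
Qed.

Section contraction.
Variable (Q : H -> H).
Hypotheses (bQ : bounded_operator Q) (sQ : symmetric_operator Q).
Hypothesis (cQ : forall x, nrm (Q x) <= nrm x).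

Let Y := sqrt_iter Q.
Let y := sqrt_majorant.

Lemma bop_sqrt_iter n : bounded_operator (Y n).
Proof.
elim: n => [|n IH].
  apply: (@bopI _ _ _ 0) => [u v|c u|u] /=;
    by rewrite ?addr0 ?scaler0 // nrm0 mul0r.
by apply: bop_scale; apply: bop_add => //; apply: bop_comp.
Qed.

Lemma sqrt_iterS n x : Y n.+1 x = (2^-1)%:C *: (Q x + Y n (Y n x)).
Proof. by []. Qed.

Lemma symmetric_sqrt_iter n : symmetric_operator (Y n).
Proof.
elim: n => [|n IH]; move=> u v; first by rewrite /Y /= /rip linear0l linear0r.
by rewrite !sqrt_iterS ripZl ripZr ripDl ripDr sQ !IH.
Qed.

Lemma sqrt_iter_bound n x : nrm (Y n x) <= y n * nrm x.
Proof.
elim: n x => [|n IH] x; first by rewrite /= nrm0 mul0r.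
rewrite sqrt_iterS nrmZr ger0_norm ?invr_ge0 //.
have := nrmD (Q x) (Y n (Y n x)); have := cQ x; have := IH (Y n x).
have := ler_wpM2l (sqrt_majorant_ge0 n) (IH x); rewrite /y /= -/y.
move: (nrm _) (nrm _) (nrm _) (nrm _) (nrm _) (y n) => a b c d e f; nra.
Qed.

(** Writing [Y'] for the next iterate after [Y], the step after that is
    [(Y'^2 - Y^2) / 2 = (Y' (Y' - Y) + (Y' - Y) Y) / 2]; the scalar sequence
    satisfies the same identity, so it majorizes every increment. *)
Lemma sqrt_iter_incr n x : nrm (Y n.+1 x - Y n x) <= (y n.+1 - y n) * nrm x.
Proof.
elim: n x => [|n IH] x.
  by rewrite subr0 [y 0]/= subr0; exact: sqrt_iter_bound.
have -> : Y n.+2 x - Y n.+1 x = (2^-1)%:C *: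
    (Y n.+1 (Y n.+1 x - Y n x) + (Y n.+1 (Y n x) - Y n (Y n x))).
  rewrite [in LHS]sqrt_iterS [Y n.+1 x as X in _ - X]sqrt_iterS -scalerBr.
  congr (_ *: _); rewrite (bopD (bop_sqrt_iter _)) (bopN (bop_sqrt_iter _)).
  by rewrite subrKA opprD addrACA subrr add0r.
rewrite nrmZr ger0_norm ?invr_ge0 //.
have h1 := nrmD (Y n.+1 (Y n.+1 x - Y n x)) (Y n.+1 (Y n x) - Y n (Y n x)).
have h2 := sqrt_iter_bound n.+1 (Y n.+1 x - Y n x).
have h3 := IH (Y n x).
have h4 := ler_wpM2l (sqrt_majorant_ge0 n.+1) (IH x).
have dy : 0 <= y n.+1 - y n.
  have := sqrt_majorant_bounds n; rewrite /y /= => /andP[_].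
  by have := sqr_ge0 (1 - y n); rewrite /y; nra.
have h5 := ler_wpM2l dy (sqrt_iter_bound n x).
have -> : y n.+2 = (1 + y n.+1 ^+ 2) / 2 by [].
have e1 : y n.+1 = (1 + y n ^+ 2) / 2 by [].
move: h1 h2 h3 h4 h5; rewrite -/y.
move: (nrm _) (nrm _) (nrm _) (nrm _) (nrm _) (nrm _) => a b c d e f.
nra.
Qed.

Lemma sqrt_iter_cauchy n m x : (n <= m)%N ->
  nrm (Y m x - Y n x) <= (y m - y n) * nrm x.
Proof.
move=> /subnKC <-; elim: (m - n)%N => [|k IH].
  by rewrite addn0 !subrr nrm0 mul0r.
rewrite addnS -(subrK (Y (n + k) x) (Y _ x)) -addrA.
apply: (le_trans (nrmD _ _)); have := sqrt_iter_incr (n + k) x; lra.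
Qed.

(** The iterates converge pointwise, uniformly on bounded sets; linearity,
    symmetry, the norm bound and the fixed point equation pass to the limit. *)
Lemma sqrt_iter_lim : exists Z, [/\ bounded_operator Z, symmetric_operator Z,
  (forall x, nrm (Z x) <= nrm x) &
  forall x, Z x = (2^-1)%:C *: (Q x + Z (Z x))].
Proof.
have rateY n m x : (n <= m)%N -> nrm (Y m x - Y n x) <= rate n * nrm x.
  move=> /(sqrt_iter_cauchy x) /le_trans; apply; rewrite ler_wpM2r ?nrm_ge0 //.
  have /andP[+ _] := sqrt_majorant_bounds n.
  have /andP[_] := sqrt_majorant_bounds m.
  rewrite -/y; lra.
have /choice[Z hZ] :
    forall x, exists l, forall n, nrm (l - Y n x) <= rate n * nrm x.
  move=> x; have := nrm_ge0 x; rewrite le_eqVlt => /predU1P[x0|x0].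
    exists 0 => n; rewrite -x0 mulr0 sub0r nrmN.
    by have := sqrt_iter_bound n x; rewrite -x0 mulr0.
  have [|l hl] := @cauchy_rate_cvg _ _ (fun n => ((nrm x)^-1)%:C *: Y n x).
    move=> n m nm; rewrite -scalerBr nrmZr ger0_norm ?invr_ge0 ?nrm_ge0 //.
    by rewrite mulrC ler_pdivrMr // rateY.
  (* The Cauchy estimate scales with [nrm x]: take the limit at the unit
     vector of the direction of [x], then scale back. *)
  exists ((nrm x)%:C *: l) => n; have := hl n.
  have -> : l - ((nrm x)^-1)%:C *: Y n x =
      ((nrm x)^-1)%:C *: ((nrm x)%:C *: l - Y n x).
    by rewrite scalerBr scalerA -rmorphM /= mulVf ?gt_eqF // scale1r.
  by rewrite nrmZr ger0_norm ?invr_ge0 ?nrm_ge0 // mulrC ler_pdivrMr.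
have uniq (u v : H) (K : R) : (forall n, nrm (u - v) <= K * rate n) -> u = v.
  move=> /le0_rate h; apply/eqP; rewrite -subr_eq0 -nrm_eq0.
  by rewrite eq_le h nrm_ge0.
have Z1 x : nrm (Z x) <= nrm x.
  rewrite -subr_le0; apply: (@le0_rate _ _ (nrm x)) => n.
  have := nrmD (Z x - Y n x) (Y n x); rewrite subrK.
  have /andP[_ y1] := sqrt_majorant_bounds n.
  have := ler_wpM2r (nrm_ge0 x) y1; have := sqrt_iter_bound n x; have := hZ x n.
  rewrite -/y; lra.
have ZD u v : Z (u + v) = Z u + Z v.
  apply: (@uniq _ _ (nrm (u + v) + nrm u + nrm v)) => n.
  have -> : Z (u + v) - (Z u + Z v) =
      (Z (u + v) - Y n (u + v)) - (Z u - Y n u) - (Z v - Y n v).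
    rewrite (bopD (bop_sqrt_iter n)) -[RHS]addrA -opprD [Z u - _ + _]addrACA.
    by rewrite -(opprD (Y n u)) opprB subrKA.
  apply: (le_trans (nrmD _ _)); rewrite nrmN.
  have := nrmD (Z (u + v) - Y n (u + v)) (- (Z u - Y n u)); rewrite nrmN.
  have := hZ (u + v) n; have := hZ u n; have := hZ v n; lra.
have ZZ c u : Z (c *: u) = c *: Z u.
  apply: (@uniq _ _ (nrm (c *: u) + complex.Re `|c| * nrm u)) => n.
  have -> : Z (c *: u) - c *: Z u =
      (Z (c *: u) - Y n (c *: u)) - c *: (Z u - Y n u).
    by rewrite (bopZ (bop_sqrt_iter n)) scalerBr opprB addrA subrK.
  apply: (le_trans (nrmD _ _)).
  rewrite nrmN nrmZ [complex.Re _ * nrm (_ - _)]mulrC mulrDl.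
  have c0 : 0 <= complex.Re `|c| by rewrite -ler0c RRe_real ?normr_real.
  have := ler_wpM2r c0 (hZ u n); have := hZ (c *: u) n; lra.
exists Z; split => //.
- by apply: (@bopI _ _ _ 1) => // u; rewrite mul1r.
- move=> u v.
  have le_uv (a b : H) : rip (Z a) b - rip a (Z b) <= 0.
    apply: (@le0_rate _ _ (2 * nrm a * nrm b)) => n.
    have -> : rip (Z a) b - rip a (Z b) =
        rip (Z a - Y n a) b - rip a (Z b - Y n b).
      rewrite !(ripDl, ripDr, ripNl, ripNr) symmetric_sqrt_iter; lra.
    have := rip_le (Z a - Y n a) b; have := rip_le (- a) (Z b - Y n b).
    rewrite nrmN ripNl; have := ler_wpM2r (nrm_ge0 b) (hZ a n).
    have := ler_wpM2l (nrm_ge0 a) (hZ b n).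
    lra.
  apply/eqP; rewrite eq_le -subr_le0 le_uv /= -subr_le0.
  by rewrite [rip u _]ripC [rip (Z u) v]ripC le_uv.
- move=> x; apply: (@uniq _ _ (2 * nrm x)) => n.
  have -> : Z x - (2^-1)%:C *: (Q x + Z (Z x)) =
      (Z x - Y n.+1 x) +
      (2^-1)%:C *: (Y n (Y n x - Z x) + (Y n (Z x) - Z (Z x))).
    rewrite (bopD (bop_sqrt_iter n)) (bopN (bop_sqrt_iter n)) subrKA sqrt_iterS.
    rewrite -addrA; congr (_ + _); rewrite -2!scalerN -scalerDr; congr (_ *: _).
    by rewrite opprD [in RHS]opprD subrKA.
  apply: (le_trans (nrmD _ _)); rewrite nrmZr ger0_norm ?invr_ge0 //.
  have := nrmD (Y n (Y n x - Z x)) (Y n (Z x) - Z (Z x)).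
  rewrite -(nrmN (Y n (Z x) - _)) opprB.
  have := sqrt_iter_bound n (Y n x - Z x); rewrite -(nrmN (Y n x - _)) opprB.
  have /andP[_ y1] := sqrt_majorant_bounds n.
  have := ler_wpM2r (nrm_ge0 (Z x - Y n x)) y1; rewrite -/y.
  have := hZ x n; have := hZ (Z x) n.
  have := ler_wpM2l (rate_ge0 R n) (Z1 x).
  have := hZ x n.+1.
  have : rate n.+1 * nrm x <= rate n * nrm x.
    by rewrite ler_wpM2r ?nrm_ge0 // rate_nonincreasing.
  lra.
Qed.

End contraction.

(** Rescale [P] so that [Q = 1 - P / m] satisfies [0 <= Q <= 1], hence is a
    contraction by [symmetric_bound]; then [sqrt m (1 - Y)] is the root, where
    [Y] is the fixed point of [sqrt_iter_lim]. *)
Lemma sqrt_exists P : bounded_operator P -> symmetric_operator P ->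
  (forall x, 0 <= rip (P x) x) -> exists Q, positive_operator Q /\ Q \o Q = P.
Proof.
move=> bP sP P0; have [M M0 hM] := bop_bound bP.
(* The shift by 1 only ensures that the scaling factor is positive. *)
pose m := M + 1; have m0 : 0 < m by rewrite ltr_wpDl.
pose Q x := x - (m^-1)%:C *: P x.
have bQ : bounded_operator Q.
  apply: (@bopI _ _ _ (1 + m^-1 * M)) => [u v|c u|u]; rewrite /Q.
  - by rewrite (bopD bP) scalerDr opprD addrACA.
  - by rewrite (bopZ bP) scalerBr !scalerA mulrC.
  - apply: (le_trans (nrmD _ _)).
    rewrite nrmN nrmZr ger0_norm ?invr_ge0 ?(ltW m0) //.
    by rewrite mulrDl mul1r lerD2l -mulrA ler_wpM2l // invr_ge0 ltW.
have sQ : symmetric_operator Q.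
  by move=> u v; rewrite /Q ripDl ripDr ripNl ripNr ripZl ripZr sP.
have cQ x : nrm (Q x) <= nrm x.
  rewrite -[leRHS]mul1r; apply: symmetric_bound => // z.
  rewrite /Q ripDl ripNl ripZl rip_sqr mul1r.
  have h : m^-1 * rip (P z) z <= nrm z ^+ 2.
    rewrite mulrC ler_pdivrMr // (le_trans (rip_le _ _)) //.
    have := ler_wpM2r (nrm_ge0 z) (hM z); rewrite /m; have := nrm_ge0 z; nra.
  have h0 : 0 <= m^-1 * rip (P z) z by rewrite mulr_ge0 // invr_ge0 ltW.
  by rewrite ler_norml; apply/andP; split; nra.
have [Z [bZ sZ Z1 Zeq]] := sqrt_iter_lim bQ sQ cQ.
pose s := Num.sqrt m.
pose S x := s%:C *: (x - Z x).
have bS : bounded_operator S.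
  apply: (@bopI _ _ _ (`|s| * 2)) => [u v|c u|u]; rewrite /S.
  - by rewrite (bopD bZ) -scalerDr opprD addrACA.
  - by rewrite (bopZ bZ) -scalerBr !scalerA mulrC.
  - rewrite nrmZr -mulrA ler_wpM2l //; apply: (le_trans (nrmD _ _)).
    by rewrite nrmN; have := Z1 u; lra.
exists S; split.
- apply: symmetric_positive => // [u v|u].
    by rewrite /S ripZl ripZr ripDl ripDr ripNl ripNr sZ.
  rewrite /S ripZl mulr_ge0 ?sqrtr_ge0 // ripDl ripNl rip_sqr subr_ge0.
  by rewrite (le_trans (rip_le _ _)) // expr2 ler_wpM2r ?nrm_ge0.
- apply/funext => x; rewrite /S /= (bopZ bZ) -scalerBr scalerA -rmorphM /=.
  rewrite -expr2.
  rewrite sqr_sqrtr ?ltW // (bopD bZ) (bopN bZ).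
  have -> : x - Z x - (Z x - Z (Z x)) = x - Q x.
    have : (2%:R)%:C *: Z x = Q x + Z (Z x).
      by rewrite {1}Zeq scalerA -rmorphM /= mulfV // scale1r.
    rewrite rmorph_nat scaler_nat mulr2n => /(congr1 (fun z => z - Z (Z x))).
    by rewrite addrK => <-; rewrite !opprD !opprK !addrA.
  by rewrite /Q opprB addrC subrK scalerA -rmorphM /= mulfV ?gt_eqF // scale1r.
Qed.

Lemma abs_operator_sqr X : bounded_operator X ->
  abs_operator X \o abs_operator X = adjoint X \o X.
Proof.
move=> bX; have bA := bop_adjoint bX.
have [|u v|x|Q hQ] := @sqrt_exists (adjoint X \o X).
- exact: bop_comp.
- by rewrite /= ripC -rip_adjoint // ripC rip_adjoint.
- by rewrite /= ripC -rip_adjoint // rip_sqr sqr_ge0.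
have [] := @getPex _
  [set P : H -> H | positive_operator P /\ P \o P = adjoint X \o X].
  by exists Q.
by [].
Qed.

End symmetric_operators.

(** * Operator norm and numerical radius *)

Section operator_quantities.
Variables (R : realType) (H : hilbertType R).
Implicit Types (X : H -> H) (x y : H) (c : R[i]).

Lemma phase c : exists u : R[i], `|u| = 1 /\ u * c = `|c|.
Proof.
have [->|c0] := eqVneq c 0; first by exists 1; rewrite normr1 mulr0 normr0.
exists (`|c| / c).
rewrite normrM normrV ?unitfE // normr_id divff ?normr_eq0 //.
by rewrite divfK.
Qed.

Lemma Re_normM (a b : R[i]) :
  complex.Re `|a * b| = complex.Re `|a| * complex.Re `|b|.
Proof. by have := normrM a b; rewrite !normc_def -rmorphM => /complexI. Qed.

Lemma Re_normr (a : R) : complex.Re `|a%:C| = `|a|.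
Proof. by rewrite normc_def /= expr0n addr0 sqrtr_sqr. Qed.

Lemma Re_le_norm (a : R[i]) : complex.Re a <= complex.Re `|a|.
Proof.
apply: (le_trans (ler_norm _)); rewrite -lecR.
apply: (le_trans (normc_ge_Re a)).
by rewrite RRe_real ?normr_real.
Qed.

Lemma nrm_unit c x : `|c| = 1 -> nrm (c *: x) = nrm x.
Proof. by move=> c1; rewrite nrmZ c1 mul1r. Qed.

Lemma rip_conj c x y : rip x (conjc c *: y) = rip (c *: x) y.
Proof. by rewrite /rip innerZl innerZr conjcK. Qed.

Lemma inner_le x y : complex.Re `|inner x y| <= nrm x * nrm y.
Proof.
have [u [u1 <-]] := phase (inner x y).
by rewrite -innerZl -(nrm_unit x u1) rip_le.
Qed.

Lemma opnorm_le X x : bounded_operator X -> nrm (X x) <= opnorm X * nrm x.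
Proof.
move=> bX; have [M M0 hM] := bop_bound bX.
have le1 z : `|z : H| <= 1 -> nrm z <= 1 by rewrite normE -[1]/(1%:C) lecR.
have := nrm_ge0 x; rewrite le_eqVlt => /predU1P[x0|x0].
  have /eqP := esym x0; rewrite nrm_eq0 => /eqP->.
  by rewrite (bop0 bX) !nrm0 mulr0.
pose r := (nrm x)^-1; have r0 : 0 <= r by rewrite invr_ge0 ltW.
suff : nrm (X (r%:C *: x)) <= opnorm X.
  by rewrite (bopZ bX) nrmZr ger0_norm // mulrC ler_pdivrMr.
apply: (@ub_le_sup R).
  exists M => _ [z /= /le1 z1 <-]; apply: (le_trans (hM z)).
  by rewrite -[leRHS]mulr1 ler_wpM2l.
exists (r%:C *: x) => //=; rewrite normE -[1]/(1%:C) lecR nrmZr.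
by rewrite ger0_norm // mulVf ?gt_eqF.
Qed.

Lemma opnorm_gt0 X : bounded_operator X -> X <> (fun=> 0) -> 0 < opnorm X.
Proof.
move=> bX X0; rewrite ltNge; apply/negP => h; apply: X0; apply/funext => x.
apply/eqP; rewrite -nrm_eq0 eq_le nrm_ge0 andbT.
by rewrite (le_trans (opnorm_le x bX)) // mulr_le0_ge0 ?nrm_ge0.
Qed.

Lemma numerical_radius_le X x : bounded_operator X ->
  complex.Re `|inner (X x) x| <= numerical_radius X * nrm x ^+ 2.
Proof.
move=> bX; have [M M0 hM] := bop_bound bX.
have := nrm_ge0 x; rewrite le_eqVlt => /predU1P[x0|x0].
  have /eqP := esym x0; rewrite nrm_eq0 => /eqP->.
  by apply: (le_trans (inner_le _ _)); rewrite (bop0 bX) !nrm0 expr0n /= !mulr0.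
have x2 := exprn_gt0 2 x0.
pose r := (nrm x)^-1; have r0 : 0 <= r by rewrite invr_ge0 ltW.
rewrite -ler_pdivrMr //.
have -> : complex.Re `|inner (X x) x| / nrm x ^+ 2 =
    complex.Re `|inner (X (r%:C *: x)) (r%:C *: x)|.
  rewrite (bopZ bX) innerZl innerZr conjc_real !Re_normM !Re_normr.
  rewrite (ger0_norm r0).
  by rewrite -exprVn -/r; ring.
apply: (@ub_le_sup R); last first.
  by exists (r%:C *: x) => //=; rewrite normE nrmZr ger0_norm // mulVf ?gt_eqF.
exists M => _ [z /= z1 <-]; apply: (le_trans (inner_le _ _)).
have {}z1 : nrm z = 1 by rewrite /nrm z1.
by rewrite z1 mulr1 (le_trans (hM z)) // z1 mulr1.
Qed.

Lemma numerical_radius_rip X x c : bounded_operator X -> `|c| = 1 ->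
  rip (c *: X x) x <= numerical_radius X * nrm x ^+ 2.
Proof.
move=> bX c1; apply: le_trans (numerical_radius_le x bX).
rewrite -[leRHS]mul1r; have <- : complex.Re `|c| = 1 by rewrite c1.
rewrite /rip innerZl -Re_normM.
exact: Re_le_norm.
Qed.

Lemma adjointK X : bounded_operator X -> adjoint (adjoint X) = X.
Proof.
move=> bX; apply/funext => y; apply: rip_inj => x.
by rewrite -(rip_adjoint (bop_adjoint bX)) ripC -rip_adjoint // ripC.
Qed.

(** This is [|T|^2 = |T T^*|], where [T'] is the adjoint of [T]: the bound on
    [T T'] first gives [|T' y|^2 = rip (T (T' y)) y <= r |y|^2], and the same
    bound for [T] follows from [|T x|^2 = rip x (T' (T x))]. *)
Lemma sqr_norm_le_comp_adjoint (T T' : H -> H) (r : R) x :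
  (forall u v, rip (T u) v = rip u (T' v)) ->
  (forall y, nrm (T (T' y)) <= r * nrm y) -> nrm (T x) ^+ 2 <= r * nrm x ^+ 2.
Proof.
move=> adjT hr.
have hT' y : nrm (T' y) ^+ 2 <= r * nrm y ^+ 2.
  rewrite -rip_sqr -adjT (le_trans (rip_le _ _)) // expr2 mulrA.
  by rewrite ler_wpM2r ?nrm_ge0.
have h1 : nrm (T x) ^+ 2 <= nrm x * nrm (T' (T x)).
  by rewrite -rip_sqr adjT rip_le.
have h2 := hT' (T x).
have h3 : 0 <= r * nrm x := le_trans (nrm_ge0 _) (hr x).
have [t0|t0] := eqVneq (nrm (T x)) 0.
  by rewrite t0 expr0n expr2 mulrA mulr_ge0 ?nrm_ge0.
have t2 : 0 < nrm (T x) ^+ 2.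
  by rewrite exprn_gt0 // lt_neqAle eq_sym t0 nrm_ge0.
rewrite -(ler_pM2l t2) -expr2.
apply: (@le_trans _ _ ((nrm x * nrm (T' (T x))) ^+ 2)).
  by rewrite ler_sqr ?nnegrE ?sqr_ge0 // mulr_ge0 ?nrm_ge0.
rewrite exprMn; have := ler_wpM2l (sqr_ge0 (nrm x)) h2; lra.
Qed.

(** * The estimate for A B *)

Section main_estimate.
Variables (S W W' : H -> H).
Hypotheses (bS : bounded_operator S) (sS : symmetric_operator S).
Hypotheses (bW : bounded_operator W) (bW' : bounded_operator W').
Hypothesis (adjW : forall u v, rip (W u) v = rip u (W' v)).

(** With [N = c W + conj c W'], twice the real part of [c W], expand
    [|S y + N y|^2].  The middle term is [rip (S y) (N y)], which moving [S]
    and [W'] to the other side turns into the quadratic form of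
    [c (S W + W S)] at [y]; and [N] is symmetric with quadratic form
    [2 rip (c W z) z], so [symmetric_bound] controls [|N y|]. *)
Lemma norm_add_real_part c y : `|c| = 1 ->
  nrm (S y + (c *: W y + conjc c *: W' y)) ^+ 2 <=
  (opnorm S ^+ 2 + 4 * numerical_radius W ^+ 2 +
   2 * numerical_radius ((S \o W) + (W \o S))) * nrm y ^+ 2.
Proof.
move=> c1; pose N z := c *: W z + conjc c *: W' z.
have bN : bounded_operator N by apply: bop_add; apply: bop_scale.
have sN : symmetric_operator N.
  move=> u v; rewrite /N ripDl ripDr [LHS]addrC; congr (_ + _).
    by rewrite ripC rip_conj -adjW (bopZ bW) ripC.
  by rewrite rip_conj -adjW (bopZ bW).
have NE z : rip (N z) z = 2 * rip (c *: W z) z.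
  rewrite /N ripDl [rip (conjc c *: _) z]ripC rip_conj -adjW (bopZ bW).
  by rewrite mulr2n mulrDl mul1r.
have hN : nrm (N y) <= 2 * numerical_radius W * nrm y.
  apply: symmetric_bound => // z; rewrite NE.
  have := numerical_radius_rip z bW c1.
  have cN : `|- c| = 1 by rewrite normrN.
  have := numerical_radius_rip z bW cN; rewrite scaleNr ripNl => h1 h2.
  by rewrite ler_norml; apply/andP; split; lra.
have cross : 2 * rip (S y) (N y) <=
    2 * (numerical_radius ((S \o W) + (W \o S)) * nrm y ^+ 2).
  rewrite ler_pM2l // ripDr.
  have bSW : bounded_operator ((S \o W) + (W \o S)).
    by apply: bop_add; apply: bop_comp.
  apply: le_trans (numerical_radius_rip y bSW c1).
  rewrite add_opE scalerDr ripDl; apply: lerD.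
    by rewrite sS (bopZ bS) ripC.
  by rewrite rip_conj -adjW (bopZ bW).
rewrite -/(N y) nrm_sqrD.
have hS : nrm (S y) ^+ 2 <= opnorm S ^+ 2 * nrm y ^+ 2.
  have hy := opnorm_le y bS.
  by rewrite -exprMn ler_sqr ?nnegrE ?nrm_ge0 // (le_trans (nrm_ge0 _) hy).
have {}hN : nrm (N y) ^+ 2 <= 4 * numerical_radius W ^+ 2 * nrm y ^+ 2.
  have -> : 4 * numerical_radius W ^+ 2 * nrm y ^+ 2 =
      (2 * numerical_radius W * nrm y) ^+ 2 by ring.
  by rewrite ler_sqr ?nnegrE ?nrm_ge0 // (le_trans (nrm_ge0 _) hN).
lra.
Qed.

End main_estimate.

(** The pointwise form of the inequality, for an arbitrary scaling [s].  With
    [T = s^-1 c B + s A^*], polarization gives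
    [4 rip (c A (B x)) x <= |T x|^2], and [T T^*] is the operator bounded in
    [norm_add_real_part] with [W = B A]. *)
Lemma abs_inner_comp_le (A B S : H -> H) (s : R) x :
  bounded_operator A -> bounded_operator B -> 0 < s ->
  S = (s ^+ 2)%:C *: (adjoint A \o A) + (s ^- 2)%:C *: (B \o adjoint B) ->
  complex.Re `|inner (A (B x)) x| <=
  (1 / 2 * Num.sqrt (1 / 4 * opnorm S ^+ 2 + numerical_radius (B \o A) ^+ 2 +
      1 / 2 * numerical_radius ((S \o (B \o A)) + ((B \o A) \o S)))) * nrm x ^+ 2.
Proof.
move=> bA bB s0 defS; set D := (_ + _ + _ : R).
have bA' := bop_adjoint bA; have bB' := bop_adjoint bB.
have adjA := rip_adjoint bA; have adjB := rip_adjoint bB.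
have bS : bounded_operator S.
  by rewrite defS; apply: bop_add; apply: bop_scale; apply: bop_comp.
have sS : symmetric_operator S.
  move=> u v; rewrite defS !add_opE !scale_opE ripDl ripDr !ripZl !ripZr /=.
  congr (_ * _ + _ * _).
    by rewrite ripC -adjA ripC adjA.
  by rewrite adjB ripC -adjB ripC.
(* The phase [c] turns the inner product into its modulus, a nonnegative real. *)
have [c [c1 hc]] := phase (inner (A (B x)) x).
have sn0 : s != 0 by rewrite gt_eqF.
pose T z := (s^-1)%:C *: (c *: B z) + s%:C *: adjoint A z.
pose T' z := (s^-1)%:C *: (conjc c *: adjoint B z) + s%:C *: A z.
have adjT u v : rip (T u) v = rip u (T' v).
  rewrite /T /T' ripDl ripDr !ripZl !ripZr; congr (_ * _ + _ * _).
    by rewrite rip_conj -(bopZ bB) adjB.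
  by rewrite ripC -adjA ripC.
have cc : c * conjc c = 1 by rewrite -sqr_normc c1 expr1n.
have TT' y : T (T' y) =
    S y + (c *: (B \o A) y + conjc c *: (adjoint A \o adjoint B) y).
  rewrite /T /T' (bopD bB) (bopD bA') !(bopZ bB, bopZ bA') !scalerDr !scalerA.
  rewrite defS !add_opE !scale_opE /=.
  have -> : (s^-1)%:C * c * ((s^-1)%:C * conjc c) = (s ^- 2)%:C.
    by rewrite mulrACA cc mulr1 -rmorphM -expr2 exprVn.
  have -> : (s^-1)%:C * c * s%:C = c by rewrite mulrAC -rmorphM mulVf // mul1r.
  have -> : s%:C * ((s^-1)%:C * conjc c) = conjc c.
    by rewrite mulrA -rmorphM mulfV // mul1r.
  have -> : s%:C * s%:C = (s ^+ 2)%:C by rewrite -rmorphM -expr2.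
  by rewrite [_ + (s ^+ 2)%:C *: _]addrC addrACA [_ + (s ^+ 2)%:C *: _]addrC.
have rho y : nrm (T (T' y)) <= (2 * Num.sqrt D) * nrm y.
  have adjW u v : rip ((B \o A) u) v = rip u ((adjoint A \o adjoint B) v).
    by rewrite /= adjB adjA.
  have := norm_add_real_part bS sS (bop_comp bB bA) (bop_comp bA' bB')
    adjW y c1.
  rewrite -TT' (_ : _ + _ = 4 * D); last by rewrite /D; field.
  move=> h.
  have := nrm_ge0 y; rewrite le_eqVlt => /predU1P[y0|y0].
    move: h; rewrite -y0 expr0n !mulr0 /=.
    by have := sqr_ge0 (nrm (T (T' y))); nra.
  have D0 : 0 <= D.
    rewrite -(pmulr_lge0 _ (exprn_gt0 2 y0)) -(pmulr_rge0 _ (ltr0n R 4)).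
    by rewrite mulrA (le_trans _ h) ?sqr_ge0.
  rewrite -ler_sqr ?nnegrE ?nrm_ge0 ?mulr_ge0 ?sqrtr_ge0 ?nrm_ge0 //.
  by rewrite !exprMn sqr_sqrtr // -natrX.
have := sqr_norm_le_comp_adjoint x adjT rho.
have -> : complex.Re `|inner (A (B x)) x| =
    rip ((s^-1)%:C *: (c *: B x)) (s%:C *: adjoint A x).
  rewrite -hc ripZl ripZr mulrA mulVf // mul1r.
  by rewrite -adjA (bopZ bA) /rip innerZl.
(* Polarization: [4 rip u v = |u + v|^2 - |u - v|^2 <= |u + v|^2]. *)
rewrite /T; move: (_ *: (c *: B x)) (_ *: adjoint A x) => u v.
have := sqr_ge0 (nrm (u - v)); rewrite !nrm_sqrD nrmN ripNr.
lra.
Qed.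

End operator_quantities.

Theorem theorem2p3 (R : realType) (H : hilbertType R) (A B : H -> H)
  (bounded_A : bounded_operator A) (bounded_B : bounded_operator B)
  (A_neq0 : A <> (fun=> 0)) (B_neq0 : B <> (fun=> 0)) :
  let S : H -> H :=
    (opnorm B / opnorm A)%:C *: (abs_operator A \o abs_operator A) +
    (opnorm A / opnorm B)%:C *:
      (abs_operator (adjoint B) \o abs_operator (adjoint B)) in
  numerical_radius (A \o B) <=
    1 / 2 * Num.sqrt (1 / 4 * opnorm S ^+ 2 + numerical_radius (B \o A) ^+ 2 +
      1 / 2 * numerical_radius ((S \o (B \o A)) + ((B \o A) \o S))).
Proof.
cbv zeta; set S := (X in opnorm X).
have a0 := opnorm_gt0 bounded_A A_neq0; have b0 := opnorm_gt0 bounded_B B_neq0.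
(* The choice [s^2 = |B| / |A|] makes the weights those of [S], since
   [abs_operator X \o abs_operator X] is [adjoint X \o X]. *)
have defS : S = (Num.sqrt (opnorm B / opnorm A) ^+ 2)%:C *: (adjoint A \o A) +
    (Num.sqrt (opnorm B / opnorm A) ^- 2)%:C *: (B \o adjoint B).
  rewrite /S !abs_operator_sqr ?adjointK //; last exact: bop_adjoint.
  by rewrite sqr_sqrtr ?divr_ge0 ?ltW // invf_div.
(* The supremum is over a nonempty set because a nonzero operator provides a
   nonzero, hence a unit, vector. *)
apply: ge_sup => [|_ [x /= x1 <-]].
  have [x Ax] : exists x, A x != 0.
    apply: contrapT => /forallNP h; apply: A_neq0; apply/funext => x.
    by apply/eqP; apply: contrapT => /negP; apply: h.
  have x0 : 0 < nrm x.
    rewrite lt_neqAle nrm_ge0 andbT eq_sym nrm_eq0; apply: contra Ax => /eqP->.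
    by rewrite bop0.
  pose z := (nrm x)^-1%:C *: x.
  exists (complex.Re `|inner ((A \o B) z) z|); exists z => //=; rewrite /z.
  by rewrite normE nrmZr ger0_norm ?invr_ge0 ?(ltW x0) // mulVf ?gt_eqF.
have {}x1 : nrm x = 1 by rewrite /nrm x1.
have s0 : 0 < Num.sqrt (opnorm B / opnorm A) by rewrite sqrtr_gt0 divr_gt0.
have := abs_inner_comp_le x bounded_A bounded_B s0 defS.
by rewrite x1 expr1n mulr1.
Qed.
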